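(* For each even perfect number $N$, the number of representations of $N$ as a sum of three cubes of integers, $N=x^3+y^3+z^3$ with $x,y,z\in\mathbb{Z}$, is at least $2$.
   Context: A positive integer $N$ is perfect if it equals the sum of its proper divisors, i.e. $\sigma(N)=2N$ where $\sigma(N)=\sum_{d\mid N} d$. The integers $x,y,z$ may be negative or zero. Representations that differ only by the order of $x,y,z$ are regarded as the same, so the claim asserts at least two distinct multisets $\{x,y,z\}$ of integers. *)

(* Defs.v *)
From mathcomp Require Import all_boot all_order all_algebra.
From mathcomp Require Import finmap multiset.

Set Implicit Arguments.
Unset Strict Implicit.
Unset Printing Implicit Defensive.

Import GRing.Theory.
Local Open Scope ring_scope.
Local Open Scope mset_scope.

Definition sigma (n : nat) : nat := (\sum_(d <- divisors n) d)%N.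

(* The positivity hypothesis is needed because divisors 0 = [::]. *)
Definition perfect (n : nat) : bool := (0 < n)%N && (sigma n == 2 * n)%N.

(* Representations of n as a sum of three cubes are taken up to order: each one
   is the multiset {x, y, z}, repetitions counted. *)
Definition is_three_cubes_rep (n : int) (A : {mset int}) : Prop :=
  exists x y z : int,
    A = [mset x; y; z] /\ n = x ^+ 3 + y ^+ 3 + z ^+ 3.

(* Main.v *)
Require Import Defs.
From mathcomp Require Import all_boot all_order all_algebra.
From mathcomp Require Import finmap multiset.
From mathcomp Require Import ring zify.

(** By Euclid and Euler an even perfect number is [2 ^ (p - 1) * (2 ^ p - 1)]
    with [p] prime.  Apart from [p = 2] and [p = 3], such a [p] is congruent to
    1 or 5 modulo 6, and then the powers of two line up into cubes:
    - if [p = 6 j + 1], put [w = 2 ^ j]; then [N = 2 w ^ 12 - w ^ 6], which is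
      the sum of the cubes of [w ^ 4], [w ^ 4] and [- w ^ 2];
    - if [p = 6 j + 5], put [w = 2 ^ j] and [b = 2 w ^ 2]; then
      [N = 8 b ^ 6 - 2 b ^ 3], the sum of the cubes of [2 b ^ 2], [- b], [- b].

    A second representation is found by keeping the sum of the two equal
    entries.  Replace [(s, s, t)] by [(s + r, s - r, t + h)]: the sum of cubes
    does not change if and only if
      [6 s r ^ 2 + h (3 t ^ 2 + 3 t h + h ^ 2) = 0],
    a curve of genus one in [(r, h)].  In both cases it has a point with
    [h = 9 t / 2], for which the equation reads [16 s r ^ 2 = - 441 t ^ 3], and
    this determines a rational [r] because [- s t] is a square in the
    parameter [w].  The resulting identities are [two_reps_1mod6], where the
    fractions disappear once [w] is a multiple of 4, and [two_reps_5mod6].  This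
    leaves [p = 2], [3] and [7], that is [N = 6], [28] and [8128], which are
    settled by explicit triples. *)

Import Order.TTheory GRing.Theory Num.Theory.

(** * Even perfect numbers *)

Section EvenPerfect.
Local Open Scope nat_scope.

Lemma leq_sum_sigma s n :
  uniq s -> {subset s <= divisors n} -> \sum_(d <- s) d <= sigma n.
Proof.
move=> s_uniq s_sub; apply: (uniq_sub_le_big leqnn) => //.
  by move=> d e; apply: leq_addr.
exact: divisors_uniq.
Qed.

(** The even divisors of [2 ^ n.+1 * m] are the doubles of the divisors of
    [2 ^ n * m]; the odd ones are the divisors of [m]. *)
Lemma sigma_pow2S n m : odd m ->
  sigma (2 ^ n.+1 * m) = 2 * sigma (2 ^ n * m) + sigma m.
Proof.
move=> m_odd; have m_gt0 : 0 < m by apply: odd_gt0.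
have pos k : 0 < 2 ^ k * m by rewrite muln_gt0 expn_gt0.
have mul2_inj : injective (muln 2) by move=> x y /eqP; rewrite eqn_pmul2l // => /eqP.
rewrite /sigma big_distrr /= -(big_map (muln 2) xpredT id) -big_cat /=.
apply: perm_big; apply: uniq_perm; first exact: divisors_uniq.
  rewrite cat_uniq map_inj_uniq // !divisors_uniq andbT /=.
  apply/hasPn => d; rewrite -dvdn_divisors // => dvd_dm.
  apply/mapP => -[e _ d_eq].
  by move: (dvdn_odd dvd_dm m_odd); rewrite d_eq oddM.
move=> d; rewrite mem_cat -!dvdn_divisors // expnS -mulnA.
apply/idP/orP => [dvd_d | [/mapP[e] | dvd_dm]].
- have [d_odd | d_even] := boolP (odd d).
    right; move: dvd_d; rewrite mulnA -expnS Gauss_dvdr //.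
    by rewrite coprimeXr // coprimen2.
  left; have d_eq : d = 2 * d./2 by rewrite mul2n even_halfK.
  rewrite d_eq; apply: map_f; rewrite -dvdn_divisors //.
  by rewrite -(@dvdn_pmul2l 2) // -d_eq.
- by rewrite -dvdn_divisors // => dvd_e ->; rewrite dvdn_pmul2l.
- by rewrite dvdn_mull // dvdn_mull.
Qed.

(** Adding [sigma m] to both sides turns the recurrence [sigma_pow2S] into a
    doubling, which avoids the subtraction in [(2 ^ n.+1 - 1) * sigma m]. *)
Lemma sigma_pow2M n m : odd m ->
  sigma (2 ^ n * m) + sigma m = 2 ^ n.+1 * sigma m.
Proof.
move=> m_odd; elim: n => [|n IHn]; first by rewrite mul1n addnn -mul2n.
rewrite sigma_pow2S // -addnA addnn -mul2n -mulnDr IHn.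
by rewrite [in RHS]expnS mulnA.
Qed.

(** If [d] divides [p] then [2 ^ d - 1] divides [2 ^ p - 1]. *)
Lemma prime_mersenne p : prime (2 ^ p).-1 -> prime p.
Proof.
move=> m_prime.
have p_gt1 : 1 < p by case: p m_prime => [|[|p]].
apply/primeP; split=> // d /dvdnP[e p_eq].
have dvd_m : (2 ^ d).-1 %| (2 ^ p).-1.
  by rewrite p_eq mulnC expnM [X in _ %| X]predn_exp dvdn_mulr.
have d_gt0 : 0 < d by case: d p_eq {dvd_m} => // p0; move: p_gt1; rewrite p0 muln0.
have predK k : (2 ^ k).-1.+1 = 2 ^ k by rewrite prednK ?expn_gt0.
have [_ /(_ _ dvd_m)] := primeP m_prime.
case/pred2P => [/(congr1 succn) | /(congr1 succn)]; rewrite predK.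
  by move/eqP; rewrite -[X in _ == X](expn1 2) eqn_exp2l // => /eqP ->.
by rewrite predK => /eqP; rewrite eqn_exp2l // => ->; rewrite orbT.
Qed.

(** Writing [N = 2 ^ n * m] with [m] odd, perfection forces
    [m = (2 ^ n.+1 - 1) * q] and [sigma m = m + q].  As [q] and [m] are distinct
    divisors of [m], they are the only ones; hence [q = 1] and [m] is a prime. *)
Lemma even_perfect_euler N : ~~ odd N -> perfect N ->
  exists2 p, prime p & N = 2 ^ p.-1 * (2 ^ p).-1.
Proof.
move=> N_even /andP[N_gt0 /eqP sigmaN].
have [n [m [m_odd N_eq]]] : exists n m, odd m /\ N = 2 ^ n * m.
  have [m m_odd N_eq] := pfactor_coprime (isT : prime 2) N_gt0.
  exists (logn 2 N), m; split; last by rewrite mulnC.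
  by rewrite -coprime2n.
have n_gt0 : 0 < n.
  by case: n N_eq => // N_eq; move: N_even; rewrite N_eq mul1n m_odd.
have m_gt0 := odd_gt0 m_odd.
set M := (2 ^ n.+1).-1.
have M_eq : 2 ^ n.+1 = M.+1 by rewrite prednK ?expn_gt0.
have M_gt1 : 1 < M.
  have: 2 ^ 2 <= 2 ^ n.+1 by rewrite leq_exp2l.
  by rewrite M_eq; apply: ltnW.
have sigma_eq : M.+1 * m + sigma m = M.+1 * sigma m.
  by rewrite -M_eq -sigma_pow2M // -N_eq sigmaN N_eq expnS mulnA.
have dvd_Mm : M %| m.
  have: M %| M.+1 * m by apply/dvdnP; exists (sigma m); lia.
  by rewrite Gauss_dvdr // coprimenS.
have /dvdnP[q m_eq] := dvd_Mm.
have sigma_m : sigma m = m + q.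
  have /eqP : M * sigma m = M * (m + q) by rewrite m_eq in sigma_eq *; lia.
  by rewrite eqn_pmul2l ?(ltn_trans _ M_gt1) // => /eqP.
have q_ltm : q < m by rewrite m_eq; nia.
have divm d : d %| m -> d \in divisors m by rewrite dvdn_divisors.
have q_dvd : q %| m by rewrite m_eq dvdn_mulr.
have q_gt0 : 0 < q by rewrite m_eq in m_gt0; case: (q) m_gt0.
have q1 : q = 1.
  apply/eqP; apply: contraT => q_neq1.
  have: \sum_(d <- [:: 1; q; m]) d <= sigma m.
    apply: leq_sum_sigma; first by rewrite /= !inE; lia.
    by move=> d; rewrite !inE => /or3P[] /eqP->; apply: divm.
  by rewrite !big_cons big_nil sigma_m; lia.
have mM : m = M by rewrite m_eq q1 mul1n.
exists n.+1; last by rewrite N_eq mM.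
apply: prime_mersenne; rewrite -/M -mM.
apply/primeP; split=> [|d dvd_d]; first by rewrite mM.
apply: contraT; rewrite /= negb_or => /andP[d_neq1 d_neqm].
have: \sum_(e <- [:: 1; d; m]) e <= sigma m.
  apply: leq_sum_sigma; first by rewrite /= !inE; lia.
  by move=> e; rewrite !inE => /or3P[] /eqP->; apply: divm.
have d_gt0 := dvdn_gt0 m_gt0 dvd_d.
by rewrite !big_cons big_nil sigma_m q1; lia.
Qed.

(** The prime 7 is set apart from its residue class because [two_reps_1mod6]
    produces integers only from [p = 13] on. *)
Lemma prime_mod6 p : prime p ->
  [\/ p \in [:: 2; 3; 7], exists j, p = 6 * j.+2 + 1 | exists j, p = 6 * j + 5].
Proof.
move=> p_prime; have p_gt1 := prime_gt1 p_prime.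
have [p_eq2 | p_neq2] := eqVneq p 2; first by rewrite p_eq2; apply: Or31.
have [p_eq3 | p_neq3] := eqVneq p 3; first by rewrite p_eq3; apply: Or31.
have [p_eq7 | p_neq7] := eqVneq p 7; first by rewrite p_eq7; apply: Or31.
have ndvd q : prime q -> p != q -> ~~ (q %| p).
  by move=> q_prime p_neq; rewrite dvdn_prime2 // eq_sym.
have ndvd2 := ndvd 2 isT p_neq2; have ndvd3 := ndvd 3 isT p_neq3.
have [p1 | p5] : p %% 6 = 1 \/ p %% 6 = 5 by lia.
  by apply: Or32; exists (p %/ 6 - 2); lia.
by apply: Or33; exists (p %/ 6); lia.
Qed.

End EvenPerfect.

(** * Pairs of representations *)

Local Open Scope ring_scope.
Local Open Scope mset_scope.

Definition two_reps (n : int) : Prop :=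
  exists A B : {mset int},
    A <> B /\ is_three_cubes_rep n A /\ is_three_cubes_rep n B.

Lemma two_reps_of_triples (n x y z x' y' z' : int) :
  n = x ^+ 3 + y ^+ 3 + z ^+ 3 -> n = x' ^+ 3 + y' ^+ 3 + z' ^+ 3 ->
  x \notin [:: x'; y'; z'] -> two_reps n.
Proof.
move=> n_eq n_eq' x_notin; exists [mset x; y; z], [mset x'; y'; z'].
split; last by split; [exists x, y, z | exists x', y', z'].
move=> /msetP/(_ x); rewrite !msetE2 !msetnE eqxx.
by move: x_notin; rewrite !inE; do 3!case: eqP => // _.
Qed.

(** The number [2 w ^ 12 - w ^ 6] at [w = 4 v]. The factor 4 clears the
    denominators of the second representation, whose entries are
    [w ^ 4 + 21 w / 4], [w ^ 4 - 21 w / 4] and [- 11 w ^ 2 / 2]. *)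
Lemma two_reps_1mod6 (v : int) : 0 < v ->
  two_reps (2 * (4 * v) ^+ 12 - (4 * v) ^+ 6).
Proof.
move=> v_gt0.
apply: (@two_reps_of_triples _ ((4 * v) ^+ 4) ((4 * v) ^+ 4) (- (4 * v) ^+ 2)
  ((4 * v) ^+ 4 + 21 * v) ((4 * v) ^+ 4 - 21 * v) (- 88 * v ^+ 2)); try ring.
have v2_gt0 : 0 < v ^+ 2 by rewrite exprn_gt0.
have v4_gt0 : 0 < (4 * v) ^+ 4 by rewrite exprn_gt0 // mulr_gt0.
by rewrite !inE; lia.
Qed.

(** With [b = 2 w ^ 2], the entry [11 b ^ 2] exceeds the entries of the second
    triple, so the two representations differ; here the point [h = 9 t / 2] has
    integer coordinates because [t = 2 b ^ 2] is even. *)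
Lemma two_reps_5mod6 (w : int) : 0 < w ->
  two_reps (8 * (2 * w ^+ 2) ^+ 6 - 2 * (2 * w ^+ 2) ^+ 3).
Proof.
move=> w_gt0; pose b := 2 * w ^+ 2.
have b_gt0 : 0 < b by rewrite mulr_gt0 // exprn_gt0.
apply: (@two_reps_of_triples _ (11 * b ^+ 2)
  (- b + 21 * w * b ^+ 2) (- b - 21 * w * b ^+ 2) (2 * b ^+ 2) (- b) (- b));
  rewrite /b; try ring.
have b2_gt0 : 0 < b ^+ 2 by rewrite exprn_gt0.
by rewrite -/b !inE; lia.
Qed.

Lemma euler_numberE p :
  (2 ^ p.-1 * (2 ^ p).-1)%N%:Z = 2 ^+ p.-1 * (2 ^+ p - 1).
Proof.
by rewrite PoszM -[(2 ^ p).-1]subn1 -subzn ?expn_gt0 // -!natz !natrX.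
Qed.

Theorem corollary2p3 (N : nat) (Neven : ~~ odd N) (Nperfect : perfect N) :
  exists A B : {mset int},
    A <> B /\ is_three_cubes_rep N%:Z A /\ is_three_cubes_rep N%:Z B.
Proof.
have [p p_prime ->] := even_perfect_euler _ Neven Nperfect.
rewrite -/(two_reps _) euler_numberE.
have pow2_gt0 k : 0 < 2 ^+ k :> int by rewrite exprn_gt0.
case: (prime_mod6 p p_prime) => [| [j ->] | [j ->]].
- rewrite !inE => /or3P[] /eqP-> /=.
  + exact: (@two_reps_of_triples 6 2 (-1) (-1) 65 (-43) (-58)).
  + exact: (@two_reps_of_triples 28 0 1 3 14 13 (-17)).
  + exact: (@two_reps_of_triples 8128 28 (-24) 0 16 16 (-4)).
- have := two_reps_1mod6 _ (pow2_gt0 j); congr two_reps.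
  have -> : (6 * j.+2 + 1)%N.-1 = (j * 6 + 12)%N by lia.
  have -> : (6 * j.+2 + 1)%N = (j * 6 + 13)%N by lia.
  by rewrite !exprD !exprM; ring.
- have := two_reps_5mod6 _ (pow2_gt0 j); congr two_reps.
  have -> : (6 * j + 5)%N.-1 = (j * 6 + 4)%N by lia.
  have -> : (6 * j + 5)%N = (j * 6 + 5)%N by lia.
  by rewrite !exprD !exprM; ring.
Qed.
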